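(* There is a sequence of unweighted trees $B_h$ ($h\ge1$, all edge weights equal to $1$) of maximum degree at most $3$ (exactly $3$ for $h\ge2$), with $n_h=2^{h+1}-1$ vertices, such that $$\frac{\operatorname{OPT}_{\mathrm{card}}(B_h)}{\operatorname{OPT}_{\mathrm{free}}(B_h)}=\Theta(\log n_h),$$ i.e. there are constants $0<c\le C$ such that the ratio lies in $[c\log n_h,\,C\log n_h]$ for all $h\ge1$. Moreover, for every $h$ and every vertex set $S$ with $|S|\ge2$ inducing a connected subgraph of $B_h$, one has $\operatorname{frag}_{1/3}(S)\le1$.
   Context: For a finite connected graph $G=(V,E,w)$ with positive weights, $d_G$ is the shortest-path metric of $(V,E)$ with every edge of length $1$. $\operatorname{OPT}_{\mathrm{free}}(G)$ is the minimum of $\sum_{xy\in E}w_{xy}u(x,y)$ over all ultrametrics $u$ on $V$ (metrics with $u(x,y)\le\max\{u(x,z),u(z,y)\}$) with $u\ge d_G$ on all pairs. A rooted binary hierarchy $H$ on $V$ is a rooted tree whose leaves are the vertices of $V$ and whose internal nodes have exactly two children; $C_H(x,y)$ is the set of leaves below the lowest common ancestor of $x,y$; $h_H(x,x)=0$ and $h_H(x,y)=|C_H(x,y)|-1$ for $x\ne y$. $\operatorname{OPT}_{\mathrm{card}}(G)$ is the minimum of $\sum_{xy\in E}w_{xy}h_H(x,y)$ over all rooted binary hierarchies $H$ on $V$ with $h_H\ge d_G$ on all pairs. For $S\subseteq V$ with $G[S]$ connected and $|S|\ge2$, and $\alpha\in(0,1/2]$, $\operatorname{frag}_\alpha(S)$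 is the minimum of $(|S|-1)\,w(A,B)/W(S)$ over all bipartitions $S=A\mathbin{\dot\cup}B$ with $G[A],G[B]$ connected (nonempty) and $\max\{|A|-1,|B|-1\}\le(1-\alpha)(|S|-1)$ ($+\infty$ if none exists), where $W(S)$ is the total weight of edges of $G[S]$ and $w(A,B)$ the total weight of edges between $A$ and $B$. *)

(* Defs.v *)
From HB Require Import structures.
From mathcomp Require Import all_boot all_order all_algebra.
From mathcomp Require Import all_classical all_reals all_analysis.

Set Implicit Arguments.
Unset Strict Implicit.
Unset Printing Implicit Defensive.

Import Order.TTheory GRing.Theory Num.Theory.
Local Open Scope classical_set_scope.
Local Open Scope ring_scope.

(* Connectivity of the subgraph induced on S; the empty graph does not count
   as connected. *)
Definition connected_on (V : finType) (e : rel V) (S : {set V}) : bool :=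
  (S != finset.set0) &&
  [forall x in S, forall y in S,
     connect [rel a b | [&& a \in S, b \in S & e a b]] x y].

(* The values of [weight] outside the edge relation are irrelevant: every sum
   below ranges over edges only. *)
Record wgraph (R : realType) := WGraph {
  vertex :> finType;
  edge : rel vertex;
  weight : vertex -> vertex -> R;
  edge_sym : symmetric edge;
  edge_irrefl : irreflexive edge;
  edge_conn : connected_on edge [set: vertex];
  weight_sym : forall x y, weight x y = weight y x;
  weight_gt0 : forall x y, edge x y -> 0 < weight x y }.

Section Graph.
Variables (R : realType) (G : wgraph R).
Implicit Types (x y : G) (A B S : {set G}) (u : G -> G -> R).

Definition unweighted : Prop := forall x y, edge x y -> weight x y = 1.

(* Connectedness is already part of [wgraph]. *)
Definition is_tree : Prop :=
  forall p : seq G, (2 < size p)%N -> ~~ ucycleb (@edge R G) p.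

Definition degree x : nat := #|[set y | edge x y]%SET|.

Definition max_degree : nat := \max_(x : G) degree x.

Definition walk (n : nat) x y : bool :=
  [exists p : n.-tuple G, path (@edge R G) x p && (last x p == y)].

Lemma walk_ex x y : exists n, walk n x y.
Proof.
have /andP[_ /forallP /(_ x)] := edge_conn G.
rewrite finset.in_setT => /forallP /(_ y); rewrite finset.in_setT /=.
case/connectP=> p ep ->; exists (size p); apply/existsP.
exists (in_tuple p); rewrite eqxx andbT /=.
by apply: sub_path ep => a b /= /and3P[].
Qed.

Definition gdist x y : nat := ex_minn (walk_ex x y).

(* Sum over the undirected edges xy of w_xy f(x,y), for symmetric f: each edge
   is visited in both orientations, whence the factor 1/2. *)
Definition edge_sum (f : G -> G -> R) : R :=
  2^-1 * \sum_(x : G) \sum_(y : G | edge x y) weight x y * f x y.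

(* The ultrametric inequality subsumes the triangle inequality. *)
Definition ultrametric u : Prop :=
  [/\ forall x y, 0 <= u x y,
      forall x y, u x y = 0 <-> x = y,
      forall x y, u x y = u y x &
      forall x y z, u x y <= Num.max (u x z) (u z y)].

Definition dominates u : Prop := forall x y, (gdist x y)%:R <= u x y.

(* The infimum is attained: rounding a feasible u down to integers keeps it
   feasible, and u may be truncated at the diameter. *)
Definition OPT_free : R :=
  inf [set edge_sum u | u in [set u | ultrametric u /\ dominates u]].

End Graph.

Inductive btree (V : Type) : Type :=
| BLeaf of V
| BNode of btree V & btree V.

Section Hierarchy.
Variable V : finType.
Implicit Types (H : btree V) (x y : V).

Fixpoint leaves H : seq V :=
  match H with
  | BLeaf x => [:: x]
  | BNode l r => leaves l ++ leaves r
  end.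

Definition hierarchy H : Prop := perm_eq (leaves H) (enum V).

(* Subtree rooted at the lowest common ancestor of two leaves x, y of H. *)
Fixpoint lca H x y : btree V :=
  match H with
  | BLeaf _ => H
  | BNode l r =>
      if (x \in leaves l) && (y \in leaves l) then lca l x y
      else if (x \in leaves r) && (y \in leaves r) then lca r x y
      else H
  end.

Definition lca_cluster H x y : {set V} := [set z in leaves (lca H x y)]%SET.

Definition hcard H x y : nat :=
  if x == y then 0%N else #|lca_cluster H x y|.-1.

End Hierarchy.

Section GraphHierarchy.
Variables (R : realType) (G : wgraph R).
Implicit Types (A B S : {set G}).

Definition hcost (H : btree G) (x y : G) : R := (hcard H x y)%:R.

(* There are finitely many hierarchies on G, so the infimum is attained. *)
Definition OPT_card : R :=
  inf [set edge_sum (hcost H) |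
       H in [set H | hierarchy H /\ dominates (hcost H)]].

Definition inner_weight S : R :=
  2^-1 * \sum_(x in S) \sum_(y in S | edge x y) weight x y.

Definition cross_weight A B : R :=
  \sum_(x in A) \sum_(y in B | edge x y) weight x y.

Definition balanced_split (alpha : R) S A B : bool :=
  [&& A :|: B == S, [disjoint A & B],
      connected_on (@edge R G) A, connected_on (@edge R G) B &
      Num.max (#|A|%:R - 1) (#|B|%:R - 1) <= (1 - alpha) * (#|S|%:R - 1)]%SET.

(* The minimum over an empty family is +oo. *)
Definition frag (alpha : R) S : \bar R :=
  \big[Order.min/+oo%E]_(P : {set G} * {set G} | balanced_split alpha S P.1 P.2)
    ((#|S|%:R - 1) * cross_weight P.1 P.2 / inner_weight S)%:E.

End GraphHierarchy.

(* Main.v *)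
(* B_h is the complete binary tree of height h. Twice the height of the lowest
   common ancestor is an ultrametric dominating the graph distance, and since
   heights are small on most edges its cost is O(n); every dominating function
   costs at least n - 1, so OPT_free = Theta(n).
   For OPT_card, split the subtree at v into {v} + left subtree and right
   subtree, then detach v: the edge above x costs at most the size of its
   parent's subtree, O(n h) in total. Conversely, any hierarchy on a tree costs
   at least (n ln n)/2: a split of m vertices pays m - 1 for every edge it cuts,
   and splitting a connected part cuts at least one edge.
   A connected S has a highest vertex; cutting below the lowest vertex having
   more than (2|S|+1)/3 descendants in S gives a balanced split across a single
   edge, and S spans |S| - 1 edges, whence frag <= 1. *)
Require Import Defs.
From HB Require Import structures.
From mathcomp Require Import all_boot all_order all_algebra.
From mathcomp Require Import all_classical all_reals all_analysis.
From mathcomp Require Import ring lra zify.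

Set Implicit Arguments.
Unset Strict Implicit.
Unset Printing Implicit Defensive.

Import Order.TTheory GRing.Theory Num.Theory.
Local Open Scope ring_scope.

(** * Graph distance and hierarchies *)

Section GraphDistance.
Variables (R : realType) (G : wgraph R).
Implicit Types x y z : G.

Lemma gdist_le n x y : walk n x y -> (gdist x y <= n)%N.
Proof. by rewrite /gdist; case: ex_minnP => m _; apply. Qed.

Lemma gdist_walk x y : walk (gdist x y) x y.
Proof. by rewrite /gdist; case: ex_minnP. Qed.

Lemma gdistxx x : gdist x x = 0%N.
Proof.
apply/eqP; rewrite -leqn0; apply: gdist_le; apply/existsP.
by exists [tuple]; rewrite /= eqxx.
Qed.

Lemma gdist_eq0 x y : gdist x y = 0%N -> x = y.
Proof.
move=> e; have := gdist_walk x y; rewrite e => /existsP[p].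
by rewrite (tuple0 p) /= => /eqP.
Qed.

Lemma gdist_edge x y : edge x y -> (gdist x y <= 1)%N.
Proof.
move=> e; apply: gdist_le; apply/existsP; exists [tuple y].
by rewrite /= e eqxx.
Qed.

Lemma gdist_triangle x y z : (gdist x z <= gdist x y + gdist y z)%N.
Proof.
apply: gdist_le.
have /existsP[p /andP[pp /eqP lp]] := gdist_walk x y.
have /existsP[q /andP[qp /eqP lq]] := gdist_walk y z.
apply/existsP; exists [tuple of p ++ q].
by rewrite /= cat_path pp last_cat lp qp lq eqxx.
Qed.

End GraphDistance.

Section HierarchyLca.
Variable V : finType.
Implicit Types (H : btree V) (x y : V).

Lemma size_leaves_gt0 H : (0 < size (leaves H))%N.
Proof. by elim: H => //= l IHl r' _; rewrite size_cat ltn_addr. Qed.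

Lemma size_lca H x y : (size (leaves (lca H x y)) <= size (leaves H))%N.
Proof.
elim: H => //= l IHl r' IHr; rewrite size_cat.
case: ifP => _; first by rewrite (leq_trans IHl) ?leq_addr.
by case: ifP => _; [rewrite (leq_trans IHr) ?leq_addl | rewrite /= size_cat].
Qed.

Lemma uniq_lca H x y : uniq (leaves H) -> uniq (leaves (lca H x y)).
Proof.
elim: H => //= l IHl r' IHr U; have := U; rewrite cat_uniq => /and3P[Ul _ Ur].
by case: ifP => _; [exact: IHl | case: ifP => _; [exact: IHr|]].
Qed.

Lemma lca_sym H x y : lca H x y = lca H y x.
Proof.
elim: H => //= l -> r' ->.
by rewrite [in LHS]andbC [(x \in leaves r') && _]andbC.
Qed.

Lemma hcard_size H x y : uniq (leaves H) -> x != y ->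
  hcard H x y = (size (leaves (lca H x y))).-1.
Proof.
move=> U /negPf xy; rewrite /hcard xy /lca_cluster cardsE.
by have /card_uniqP-> := uniq_lca x y U.
Qed.

Lemma hcard_sym H x y : hcard H x y = hcard H y x.
Proof. by rewrite /hcard /lca_cluster lca_sym eq_sym. Qed.

Lemma hierarchy_uniq H : hierarchy H -> uniq (leaves H).
Proof. by move=> /perm_uniq ->; exact: enum_uniq. Qed.

Lemma mem_hierarchy H x : hierarchy H -> x \in leaves H.
Proof. by move=> /perm_mem ->; rewrite mem_enum. Qed.

Lemma size_hierarchy H : hierarchy H -> size (leaves H) = #|V|.
Proof. by move=> /perm_size ->; rewrite cardE. Qed.

End HierarchyLca.

(* Apply ln t <= t - 1 to t = m/(2a) and to t = m/(2b), with m = a + b. *)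
Lemma xlnx_superadd (R : realType) (a b : R) : 1 <= a -> 1 <= b ->
  (a + b) * ln (a + b) / 2 <= a * ln a / 2 + b * ln b / 2 + (a + b - 1).
Proof.
move=> a1 b1; set m := a + b.
have a0 : 0 < a by lra.
have b0 : 0 < b by lra.
have m0 : 0 < m by rewrite /m; lra.
have ln2 : ln 2 <= 1 :> R.
  have := @le_ln1Dx R 1; rewrite (_ : 1 + 1 = 2 :> R); last by lra.
  by apply; lra.
have key c : 0 < c -> c * ln m <= c * ln c + c * ln 2 + m / 2 - c.
  move=> c0; have t0 : 0 < m / (2 * c) by rewrite divr_gt0 ?mulr_gt0.
  have := @le_ln1Dx R (m / (2 * c) - 1).
  rewrite (_ : 1 + (m / (2 * c) - 1) = m / (2 * c)); last by ring.
  move=> /(_ ltac:(lra)); rewrite ln_div ?lnM ?posrE ?mulr_gt0// => le.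
  have := ler_wpM2l (ltW c0) le.
  rewrite !mulrBr mulrDr (_ : c * (m / (2 * c)) = m / 2); last first.
    by field; lra.
  by lra.
(* The two instances add up to an excess of [m * ln 2 / 2 <= m / 2], which is at most [m - 1]
   because [m >= 2]. *)
have := key a a0; have := key b b0.
have : m * ln 2 <= m by rewrite ler_piMr// ltW.
by rewrite /m !mulrDl; lra.
Qed.

(** * Rooted trees *)

Section RootedTree.
Local Open Scope nat_scope.
(** Climbing terminates because [ht] grows at each step and is bounded by [ht r]; height gaps are
    the induction measures below. [par r] is unconstrained, hence the guard in [child]. *)
Variables (V : finType) (r : V) (par : V -> V) (ht : V -> nat).
Hypothesis ht_par : forall x, x != r -> ht (par x) = (ht x).+1.
Hypothesis ht_lt_root : forall x, x != r -> ht x < ht r.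
Implicit Types (x y v t : V) (S A : {set V}).

Definition child x y := (x != r) && (par x == y).
Definition tree_edge x y := child x y || child y x.

Lemma ht_le_root x : ht x <= ht r.
Proof. by case: (eqVneq x r) => [->//|/ht_lt_root/ltnW]. Qed.

Lemma ht_child x y : child x y -> ht y = (ht x).+1.
Proof. by case/andP=> xr /eqP<-; exact: ht_par. Qed.

Lemma tree_edge_sym : symmetric tree_edge.
Proof. by move=> x y; rewrite /tree_edge orbC. Qed.

Lemma tree_edge_irrefl : irreflexive tree_edge.
Proof. by move=> x; apply/negP => /orP[] /ht_child; lia. Qed.

Lemma top_connected S t : t \in S ->
  (forall x, x \in S -> x != t -> (x != r) && (par x \in S)) ->
  connected_on tree_edge S.
Proof.
move=> tS up; apply/andP; split; first by apply/finset.set0Pn; exists t.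
set e := [rel a b | _].
have e_sym : connect_sym e.
  apply: sym_connect_sym => a b /=; rewrite tree_edge_sym.
  by case: (a \in S); case: (b \in S).
have to_top n x : ht r - ht x <= n -> x \in S -> fingraph.connect e x t.
  elim: n x => [|n IHn] x le xS; have [->|xt] := eqVneq x t => //.
    by case/andP: (up _ xS xt) => /ht_lt_root; lia.
  case/andP: (up _ xS xt) => xr pS.
  have := ht_par xr; have := ht_lt_root xr => lt eq.
  apply: (connect_trans (y := par x)); last by apply: IHn => //; lia.
  by apply: connect1; rewrite /= xS pS /tree_edge /child xr eqxx.
apply/forall_inP => x xS; apply/forall_inP => y yS.
apply: (connect_trans (to_top _ _ (leqnn _) xS)).
by rewrite e_sym (to_top _ _ (leqnn _) yS).
Qed.

Lemma tree_connected : connected_on tree_edge [set: V]%SET.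
Proof.
apply: (top_connected (t := r)); first by rewrite finset.in_setT.
by move=> x _ xr; rewrite xr finset.in_setT.
Qed.

(** A lowest vertex of a cycle has no child on it, so both its neighbours there are its parent; but
    a cycle of length at least three makes them distinct. *)
Lemma tree_acyclic (p : seq V) : 2 < size p -> ~~ ucycleb tree_edge p.
Proof.
move=> p2; apply/negP => /andP[cyc unq].
case: p p2 cyc unq => [//|z p] p2 cyc unq.
have [m mp mmin] : exists2 m, m \in z :: p & forall x, x \in z :: p -> ht m <= ht x.
  case: (arg_minnP ht (mem_head z p : (mem (z :: p)) z)) => m mp mmin.
  by exists m => // x; exact: mmin.
have [i s def_s] := rot_to mp.
have : cycle tree_edge (m :: s) by rewrite -def_s rot_cycle.
have : uniq (m :: s) by rewrite -def_s rot_uniq.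
have sub : {subset m :: s <= z :: p} by move=> x; rewrite -def_s mem_rot.
have ss : 1 < size s by move: p2; rewrite -(size_rot i) def_s.
case: s ss sub {def_s} => [//|a s] ss sub.
case: (lastP s) ss sub => [//|{}s b] _ sub /=.
rewrite rcons_path last_rcons => /andP[_ /andP[]].
rewrite mem_rcons inE negb_or => /andP[/eqP ab _] _ /and3P[ma _ bm].
apply: ab.
have up y : y \in z :: p -> tree_edge m y -> par m = y.
  move=> yp /orP[/andP[_ /eqP//]|/ht_child]; have := mmin _ yp; lia.
rewrite -(up a _ ma) ?sub ?inE ?eqxx ?orbT//.
rewrite (up b) ?sub ?inE ?mem_rcons ?inE ?eqxx ?orbT//.
by rewrite tree_edge_sym.
Qed.

(* [anc n x] is the ancestor of [x] at height [maxn n (ht x)]. *)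
Fixpoint anc n x :=
  if n is m.+1 then
    let y := anc m x in if ht y <= m then par y else y
  else x.

Lemma anc_le n x : n <= ht x -> anc n x = x.
Proof.
elim: n => [//|n IHn] lt /=; rewrite IHn ?(ltnW lt)//.
by rewrite leqNgt lt.
Qed.

Lemma ht_anc n x : n <= ht r -> ht (anc n x) = maxn n (ht x).
Proof.
elim: n => [|n IHn] lt /=; first by rewrite max0n.
have := IHn (ltnW lt); case: ifP => le eq; last by lia.
by rewrite ht_par; [lia | apply: contraTneq lt => e; rewrite e in le; lia].
Qed.

Lemma ht_root_eq x : ht r <= ht x -> x = r.
Proof. by apply: contraTeq => /ht_lt_root; rewrite ltnNge. Qed.

Lemma anc_root x : anc (ht r) x = r.
Proof. by apply: ht_root_eq; rewrite ht_anc// leq_maxl. Qed.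

Lemma anc_par n x : x != r -> ht x < n -> anc n (par x) = anc n x.
Proof.
move=> xr; elim: n => [//|n IHn] /=; rewrite ltnS leq_eqVlt => /orP[/eqP <-|lt].
  by rewrite !anc_le ?ht_par// leqnn ltnn.
by rewrite IHn.
Qed.

Lemma anc_mono m n x y : m <= n -> anc m x = anc m y -> anc n x = anc n y.
Proof.
move=> /subnKC <-; elim: (n - m) => [|k IHk] e; first by rewrite addn0.
by rewrite addnS /= IHk.
Qed.

(** A vertex higher than [v] is left in place by [anc], so it fails the test. *)
Definition desc v x := anc (ht v) x == v.

Lemma desc_refl v : desc v v.
Proof. by rewrite /desc anc_le. Qed.

Lemma desc_ht v x : desc v x -> ht x <= ht v.
Proof. by move=> /eqP/(congr1 ht); rewrite ht_anc ?ht_le_root//; lia. Qed.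

Lemma desc_ht_eq v x : desc v x -> ht v <= ht x -> x = v.
Proof. by move=> /eqP e le; rewrite anc_le in e. Qed.

Lemma desc_up v x : desc v x -> x != v -> x != r.
Proof.
move=> d; apply: contraNneq => xr; have := desc_ht_eq d; rewrite xr => ->//.
exact: ht_le_root.
Qed.

Lemma desc_neq_ht v x : desc v x -> x != v -> ht x < ht v.
Proof. by move=> d; apply: contraNT; rewrite -leqNgt => /(desc_ht_eq d)->. Qed.

Lemma desc_par v x : x != r -> x != v -> desc v (par x) = desc v x.
Proof.
move=> xr xv; have [lt|le] := ltnP (ht x) (ht v); first by rewrite /desc anc_par.
apply/idP/idP => [/desc_ht|]; first by rewrite ht_par//; lia.
by move=> /desc_ht_eq /(_ le) e; rewrite e eqxx in xv.
Qed.

Lemma desc_par_imp v x : x != r -> desc v (par x) -> desc v x.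
Proof.
move=> xr; have [->|xv] := eqVneq x v; first by rewrite desc_refl.
by rewrite desc_par.
Qed.

(** * Trees as unweighted graphs *)

Variable R : realType.

Definition tree_graph : wgraph R :=
  @WGraph R V tree_edge (fun _ _ => 1%R) tree_edge_sym tree_edge_irrefl
    tree_connected (fun _ _ => erefl) (fun _ _ _ => ltr01).

(** Heights forbid [child] in both directions, so each edge is seen once from below and once from
    above; this cancels the factor 1/2. *)
Lemma edge_sum_tree (f : V -> V -> R) : (forall x y, f x y = f y x) ->
  edge_sum (G := tree_graph) f = (\sum_(x | x != r) f x (par x))%R.
Proof.
move=> f_sym; rewrite /edge_sum /=.
have -> : (\sum_(x : V) \sum_(y | tree_edge x y) 1 * f x y =
    \sum_(x : V) \sum_(y | child x y) f x y +
    \sum_(x : V) \sum_(y | child y x) f x y)%R.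
  rewrite -big_split; apply: eq_bigr => x _ /=.
  rewrite big_mkcond [in RHS]big_mkcond [X in (_ + X)%R]big_mkcond -big_split.
  apply: eq_bigr => y _ /=; rewrite /tree_edge mul1r.
  have : ~~ (child x y && child y x).
    by apply/andP => -[/ht_child + /ht_child]; lia.
  by case: (child x y); case: (child y x); rewrite ?addr0 ?add0r.
have -> : (\sum_(x : V) \sum_(y | child y x) f x y =
           \sum_(x : V) \sum_(y | child x y) f x y)%R.
  rewrite (exchange_big_dep xpredT)//=; apply: eq_bigr => x _.
  by apply: eq_bigr => y _; rewrite f_sym.
have -> : (\sum_(x : V) \sum_(y | child x y) f x y =
           \sum_(x | x != r) f x (par x))%R.
  rewrite [RHS]big_mkcond; apply: eq_bigr => x _.
  rewrite /child; case: (x != r) => /=; last by rewrite big_pred0.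
  by rewrite (big_pred1 (par x))// => y; rewrite eq_sym.
lra.
Qed.

(** Each step of the climb is an edge or a pause. Both directions are carried along: a detour
    through a common ancestor climbs from one vertex and descends to the other. *)
Lemma gdist_anc n x : n <= ht r ->
  gdist (G := tree_graph) x (anc n x) <= n /\
  gdist (G := tree_graph) (anc n x) x <= n.
Proof.
elim: n x => [|n IHn] x lt /=; first by rewrite gdistxx.
have [IH1 IH2] := IHn x (ltnW lt).
case: ifP => [le|_]; last by split; apply: leqW.
set y := anc n x in le IH1 IH2 *.
have yr : y != r by apply: contraTneq le => ->; rewrite -ltnNge.
have e : child y (par y) by rewrite /child yr eqxx.
have e1 : edge (w := tree_graph) y (par y) by rewrite /= /tree_edge e.
have e2 : edge (w := tree_graph) (par y) y by rewrite /= /tree_edge e orbT.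
have := gdist_triangle (G := tree_graph) x y (par y).
have := gdist_triangle (G := tree_graph) (par y) y x.
move: (gdist_edge e1) (gdist_edge e2); lia.
Qed.

Lemma gdist_common_anc m n x y : m <= ht r -> n <= ht r ->
  anc m x = anc n y -> gdist (G := tree_graph) x y <= m + n.
Proof.
move=> mh nh e; have [] := gdist_anc x mh; have [] := gdist_anc y nh.
have := gdist_triangle (G := tree_graph) x (anc m x) y.
rewrite -e; lia.
Qed.

(** * The common-ancestor ultrametric *)

Lemma common_anc_ex x y : exists n, anc n x == anc n y.
Proof. by exists (ht r); rewrite !anc_root. Qed.

(** For distinct vertices this is the height of the lowest common ancestor; taking the least meeting
    height makes it 0 on the whole diagonal. *)
Definition level x y := ex_minn (common_anc_ex x y).

Lemma levelP x y : anc (level x y) x = anc (level x y) y.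
Proof. by rewrite /level; case: ex_minnP => n /eqP. Qed.

Lemma level_le n x y : anc n x = anc n y -> level x y <= n.
Proof. by move=> /eqP e; rewrite /level; case: ex_minnP => m _; apply. Qed.

Lemma level_le_root x y : level x y <= ht r.
Proof. by apply: level_le; rewrite !anc_root. Qed.

Lemma level_sym x y : level x y = level y x.
Proof. by apply: eq_ex_minn => n; rewrite eq_sym. Qed.

Lemma level_eq0 x y : level x y = 0 <-> x = y.
Proof.
split=> [e|->]; first by have := levelP x y; rewrite e.
by apply/eqP; rewrite -leqn0; apply: level_le.
Qed.

(** Climbs that have met stay together, so at the larger level both have met the climb from [z]. *)
Lemma level_ultra x y z : level x y <= maxn (level x z) (level z y).
Proof.
apply: level_le; transitivity (anc (maxn (level x z) (level z y)) z).
  by apply: anc_mono (levelP x z); rewrite leq_maxl.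
by apply: anc_mono (levelP z y); rewrite leq_maxr.
Qed.

Lemma level_par x : x != r -> level x (par x) <= (ht x).+1.
Proof. by move=> xr; apply: level_le; rewrite anc_par. Qed.

Definition level_dist x y : R := (2 * level x y)%:R.

Lemma level_dist_ultrametric : ultrametric (G := tree_graph) level_dist.
Proof.
split=> [x y|x y|x y|x y z]; rewrite /level_dist.
- exact: ler0n.
- split=> [/eqP|/level_eq0->]; last by rewrite muln0.
  by rewrite pnatr_eq0 muln_eq0 /= => /eqP/level_eq0.
- by rewrite level_sym.
- by rewrite -natr_max ler_nat maxEnat; have := level_ultra x y z; lia.
Qed.

Lemma level_dist_dominates : dominates (G := tree_graph) level_dist.
Proof.
move=> x y; rewrite /level_dist ler_nat mul2n -addnn.
exact: gdist_common_anc (level_le_root _ _) (level_le_root _ _) (levelP x y).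
Qed.

Local Open Scope ring_scope.

(** Each vertex other than the root has one edge above it, with ends at distance at least 1. This
    also supplies the lower bound that [ge_inf] asks for, for both optima. *)
Lemma edge_sum_dominating_ge (f : V -> V -> R) : (forall x y, f x y = f y x) ->
  dominates (G := tree_graph) f ->
  #|V|%:R - 1 <= edge_sum (G := tree_graph) f.
Proof.
move=> f_sym f_dom; rewrite edge_sum_tree//.
have -> : #|V|%:R - 1 = \sum_(x | x != r) 1 :> R.
  rewrite sumr_const -[#|V|]prednK; last by apply/card_gt0P; exists r.
  by rewrite -natr1 addrK -(cardC1 r); congr (_%:R); apply: eq_card => x.
apply: ler_sum => x xr; apply: le_trans (f_dom _ _).
rewrite ler1n lt0n; apply/eqP => /gdist_eq0 /(congr1 ht).
by rewrite ht_par//; lia.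
Qed.

Lemma OPT_free_tree_ge : #|V|%:R - 1 <= OPT_free tree_graph.
Proof.
apply: lb_le_inf.
  (* The infimum of an empty set would be the default 0, so a feasible ultrametric is exhibited. *)
  exists (edge_sum (G := tree_graph) level_dist); exists level_dist => //.
  by split; [exact: level_dist_ultrametric | exact: level_dist_dominates].
move=> _ [u [[_ _ us _] ud] <-]; exact: edge_sum_dominating_ge.
Qed.

Lemma OPT_free_tree_le :
  OPT_free tree_graph <= (\sum_x 2 * (ht x).+1)%:R.
Proof.
apply: (@le_trans _ _ (edge_sum (G := tree_graph) level_dist)).
  apply: ge_inf; last first.
    exists level_dist => //.
    by split; [exact: level_dist_ultrametric | exact: level_dist_dominates].
  exists (#|V|%:R - 1) => _ [u [[_ _ us _] ud] <-].
  exact: edge_sum_dominating_ge.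
rewrite edge_sum_tree; last by move=> x y; rewrite /level_dist level_sym.
rewrite natr_sum [leRHS](bigID (fun x => x != r))/= ler_wpDr//.
  by apply: sumr_ge0 => x _; exact: ler0n.
by apply: ler_sum => x xr; rewrite ler_nat leq_mul2l /= level_par.
Qed.

(** * Lower bound for hierarchies *)

(** Each edge induced on [s] is counted at its lower endpoint. *)
Definition inner_edges (s : seq V) : nat :=
  count (fun x => (x != r) && (par x \in s)) s.

(* A vertex of maximal height has its parent outside [s]. *)
Lemma inner_edges_lt (s : seq V) : s != [::] -> (inner_edges s < size s)%N.
Proof.
case: s => [//|x0 s] _; rewrite /inner_edges.
case: (arg_maxnP ht (mem_head x0 s : (mem (x0 :: s)) x0)) => m ms mmax.
rewrite -[leqRHS](count_predC (fun x => (x != r) && (par x \in x0 :: s))).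
rewrite -addn1 leq_add2l -has_count; apply/hasP; exists m => //=.
apply/negP => /andP[mr /mmax]; rewrite ht_par//=; lia.
Qed.

(** Only edges with both ends among the leaves are charged, so that the cost makes sense for the
    subtrees met in an induction on [H]. *)
Definition tree_cost (H : btree V) : nat :=
  \sum_(x <- leaves H | (x != r) && (par x \in leaves H))
     (size (leaves (lca H x (par x)))).-1.

(** A node charges its size minus 1 to each edge it cuts, and the cut edges are those of [H] inside
    neither half. Their number is a difference, moved across the equation to stay in [nat]. *)
Lemma tree_cost_node (H1 H2 : btree V) :
  let H := BNode H1 H2 in uniq (leaves H) ->
  (tree_cost H + (size (leaves H)).-1 *
     (inner_edges (leaves H1) + inner_edges (leaves H2)) =
   tree_cost H1 + tree_cost H2 +
     (size (leaves H)).-1 * inner_edges (leaves H))%N.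
Proof.
move=> H; rewrite [leaves H]/= => U.
have disj x : x \in leaves H1 -> x \in leaves H2 -> False.
  move=> x1 x2; move: U; rewrite cat_uniq => /and3P[_ /hasPn/(_ _ x2)].
  by rewrite /= x1.
set s := leaves H1 ++ leaves H2; set k := (size s).-1.
(* The edge above a leaf of [Hi] either stays in [Hi] and is paid there, or is cut at the price
   [k]. *)
have side (Hi : btree V) : {subset leaves Hi <= s} ->
  (forall x, x \in leaves Hi -> par x \in s ->
     (size (leaves (lca H x (par x)))).-1 =
     if par x \in leaves Hi then (size (leaves (lca Hi x (par x)))).-1 else k) ->
  (\sum_(x <- leaves Hi | (x != r) && (par x \in s))
      (size (leaves (lca H x (par x)))).-1 + k * inner_edges (leaves Hi) =
   tree_cost Hi + k * count (fun x => (x != r) && (par x \in s)) (leaves Hi))%N.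
  move=> sub lcaE; rewrite /inner_edges /tree_cost -!sum1_count !big_distrr /=.
  rewrite big_mkcond [X in (_ + X)%N]big_mkcond.
  rewrite [X in _ = (X + _)%N]big_mkcond [X in _ = (_ + X)%N]big_mkcond.
  rewrite -!big_split; apply: eq_big_seq => x xi /=.
  case: eqVneq => //= xr; have := lcaE x xi; have := sub (par x).
  case: (par x \in s) => [_ ->//|]; first by case: ifP => _; lia.
  by case: (par x \in leaves Hi) => // /(_ isT).
have side1 := side H1; have side2 := side H2.
have costE : tree_cost H =
  (\sum_(x <- leaves H1 | (x != r) && (par x \in s))
      (size (leaves (lca H x (par x)))).-1 +
   \sum_(x <- leaves H2 | (x != r) && (par x \in s))
      (size (leaves (lca H x (par x)))).-1)%N.
  by rewrite /tree_cost [leaves H]/= big_cat.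
have edgeE : inner_edges s =
    (count (fun x => (x != r) && (par x \in s)) (leaves H1) +
     count (fun x => (x != r) && (par x \in s)) (leaves H2))%N.
  by rewrite /inner_edges count_cat.
rewrite costE edgeE !mulnDr addnACA side1 ?side2 1?addnACA//.
- by move=> x; rewrite mem_cat orbC => ->.
- move=> x x2 _; rewrite /H /= x2.
  have [/disj/(_ x2)//|_ /=] := boolP (x \in leaves H1).
  by case: ifP.
- by move=> x; rewrite mem_cat => ->.
- move=> x x1 _; rewrite /H /= x1.
  have [/(disj _ x1)//|_ /=] := boolP (x \in leaves H2).
  by case: ifP.
Qed.

(* [m - inner_edges] is the number of components of the forest induced on the
   leaves of [H]. Cutting [e] edges at a node of size [m] costs [(m - 1) e], so
   components beyond the first are charged at most [m - 1] each; what remains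
   obeys the recursion of [(m ln m) / 2]. *)
Lemma tree_cost_ge (H : btree V) (m : R) : uniq (leaves H) ->
  m = (size (leaves H))%:R ->
  m * ln m / 2 <=
    (tree_cost H)%:R + (m - 1) * (m - 1 - (inner_edges (leaves H))%:R).
Proof.
elim: H m => [x|H1 IH1 H2 IH2] m U mS.
  by rewrite mS /= ln1 mulr0 mul0r subrr mul0r addr0 ler0n.
have node := tree_cost_node U; move: U; rewrite [leaves _]/= => U.
have := U; rewrite cat_uniq => /and3P[U1 _ U2].
have gt0 (K : btree V) : 1 <= (size (leaves K))%:R :> R.
  by rewrite ler1n size_leaves_gt0.
have edges (K : btree V) :
    (inner_edges (leaves K))%:R <= (size (leaves K))%:R - 1 :> R.
  rewrite lerBrDr natr1 ler_nat; apply: inner_edges_lt.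
  by case: (leaves K) (size_leaves_gt0 K).
have := IH1 _ U1 erefl; have := IH2 _ U2 erefl; have := xlnx_superadd (gt0 H1) (gt0 H2).
have := edges H1; have := edges H2; have := gt0 H1; have := gt0 H2.
have mE : m = (size (leaves H1))%:R + (size (leaves H2))%:R.
  by rewrite mS size_cat natrD.
rewrite -mE.
have {node} := congr1 (fun n => n%:R : R) node.
rewrite [leaves _]/= !natrD !natrM !natrD.
have -> : (size (leaves H1 ++ leaves H2)).-1%:R = m - 1 :> R.
  rewrite mS -[X in _ = X%:R - 1]prednK ?size_cat ?addn_gt0 ?size_leaves_gt0//.
  by rewrite -natr1 addrK.
rewrite -/(leaves (BNode H1 H2)).
move: (tree_cost H1)%:R (tree_cost H2)%:R (tree_cost (BNode H1 H2))%:R.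
move: (inner_edges (leaves H1))%:R (inner_edges (leaves H2))%:R.
move: (inner_edges (leaves (BNode H1 H2)))%:R (m * ln m / 2).
move: (_ * ln _ / 2) (_ * ln _ / 2).
clear mS; move: mE; move: (size (leaves H1))%:R (size (leaves H2))%:R m.
move=> a b m -> f2 f1 e f e1 e2 c1 c2 c node b1 a1 le2 le1 lef lec2 lec1.
(* The charge per extra component rises from [a - 1] and [b - 1] in the halves to [a + b - 1]; [p1]
   and [p2] are these increases. The remaining [a + b - 1] matches the extra term of
   [xlnx_superadd]. *)
have p1 : 0 <= b * (a - 1 - e1) by apply: mulr_ge0; lra.
have p2 : 0 <= a * (b - 1 - e2) by apply: mulr_ge0; lra.
lra.
Qed.

Lemma tree_cost_hierarchy (H : btree V) : hierarchy H ->
  (tree_cost H)%:R = edge_sum (G := tree_graph) (hcost (G := tree_graph) H).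
Proof.
move=> hH; rewrite edge_sum_tree; last by move=> x y; rewrite /hcost hcard_sym.
rewrite /tree_cost (perm_big _ hH) /= natr_sum big_enum_cond /=.
apply: eq_big => x; first by rewrite mem_hierarchy// andbT.
move=> /andP[xr _]; rewrite /hcost hcard_size ?hierarchy_uniq//.
by apply/eqP => /(congr1 ht); rewrite ht_par//; lia.
Qed.

Lemma inner_edges_hierarchy (H : btree V) : hierarchy H ->
  inner_edges (leaves H) = #|V|.-1.
Proof.
move=> hH; rewrite /inner_edges (permP hH) -(cardC1 r) -sum1_count -sum1_card.
rewrite big_enum_cond; apply: eq_bigl => x.
by rewrite mem_hierarchy// !inE andbT.
Qed.

(** The leaves of a full hierarchy induce the whole tree, with [#|V| - 1] edges, so the component
    term of [tree_cost_ge] vanishes. [H0] shows that the infimum ranges over a nonempty family. *)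
Lemma OPT_card_tree_ge (H0 : btree V) : hierarchy H0 ->
  dominates (G := tree_graph) (hcost (G := tree_graph) H0) ->
  #|V|%:R * ln #|V|%:R / 2 <= OPT_card tree_graph.
Proof.
move=> H0h H0d; apply: lb_le_inf.
  by exists (edge_sum (G := tree_graph) (hcost (G := tree_graph) H0)); exists H0.
move=> _ [H [Hh _] <-]; rewrite -tree_cost_hierarchy//.
have := tree_cost_ge (hierarchy_uniq Hh) erefl.
rewrite inner_edges_hierarchy// size_hierarchy// => /le_trans; apply.
have : (0 < #|V|)%N by apply/card_gt0P; exists r.
by case: #|V| => // n _; rewrite -natr1 addrK subrr mulr0 addr0.
Qed.

Local Close Scope ring_scope.

(** * Balanced splits *)

Lemma desc_child v x : desc v x -> x != v -> exists2 c, child c v & desc c x.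
Proof.
have [n] := ubnP (ht v - ht x); elim: n x => // n IHn x lt d xv.
have xr := desc_up d xv; have htx := ht_par xr; have := desc_neq_ht d xv => ltv.
have [pv|pv] := eqVneq (par x) v.
  by exists x; [rewrite /child xr pv eqxx | exact: desc_refl].
have [||//|c cv dc] := IHn (par x); first by lia.
  by rewrite desc_par.
by exists c => //; exact: desc_par_imp.
Qed.

(** A walk inside [S] leaves the descendants of [x] only through the edge from [x] to its parent. If
    that edge is missing, the highest vertex [t], reached from [x], lies below [x] and hence equals
    it. *)
Lemma connected_top S : connected_on tree_edge S ->
  exists t, [/\ t \in S, forall x, x \in S -> ht x <= ht t &
    forall x, x \in S -> x != t -> (x != r) && (par x \in S)].
Proof.
case/andP=> /finset.set0Pn[x0 x0S] conn.
case: (arg_maxnP ht (x0S : mem S x0)) => t tS tmax; exists t; split=> // x xS.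
apply: contraNT => up; apply/eqP/esym; apply: desc_ht_eq (tmax x xS).
have /forall_inP/(_ x xS)/forall_inP/(_ t tS)/connectP[p + ->] := conn.
move: {2 3 5}x (desc_refl x); elim: p => [//|b p IHp] a da /=.
case/andP=> /and3P[aS bS e] pb.
apply: IHp pb; case/orP: e => /andP[nr /eqP ab]; last first.
  by apply: desc_par_imp; rewrite ?ab.
rewrite -ab desc_par//; apply: contraNneq up => <-.
by rewrite nr ab.
Qed.

(** At most two children per vertex: [lc] and [rc] must cover them but may take any value where a
    child is missing. *)
Variables lc rc : V -> V.
Hypothesis child_lrc : forall c v, child c v -> c = lc v \/ c = rc v.

Section BalancedSplit.
Variables (S : {set V}) (t : V).
Hypothesis tS : t \in S.
Hypothesis tmax : forall x, x \in S -> ht x <= ht t.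
Hypothesis S_up : forall x, x \in S -> x != t -> (x != r) && (par x \in S).

Let D v := [set x in S | desc v x]%SET.

Lemma desc_top x : x \in S -> desc t x.
Proof.
have [n] := ubnP (ht t - ht x); elim: n x => // n IHn x lt xS.
have [->|xt] := eqVneq x t; first exact: desc_refl.
case/andP: (S_up xS xt) => xr pS; apply: desc_par_imp => //.
by apply: IHn => //; have := tmax pS; rewrite ht_par//; lia.
Qed.

Lemma anc_in_top c x : x \in S -> desc c x -> ht c <= ht t -> c \in S.
Proof.
have [n] := ubnP (ht c - ht x); elim: n x => // n IHn x lt xS dx ct.
have [<-//|xc] := eqVneq x c.
have ltc := desc_neq_ht dx xc.
have xt : x != t by apply: contraTneq ct => <-; rewrite -ltnNge.
case/andP: (S_up xS xt) => xr pS; apply: (IHn (par x)) => //.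
  by rewrite ht_par//; lia.
by rewrite desc_par.
Qed.

(* Descend from [t] to a lowest [v] whose part is too heavy; its heavier child
   then cuts off at least (|S| - 1)/3 vertices. *)
Lemma balanced_child : 1 < #|S| ->
  exists c, [/\ c \in S, ht c < ht t, 3 * #|D c| <= (2 * #|S|).+1
    & #|S| <= 3 * #|D c|].
Proof.
move=> S2; have Dt : D t = S.
  by apply/setP => x; rewrite inE; case xS: (x \in S); rewrite //= desc_top.
pose heavy v := (v \in S) && ((2 * #|S|).+1 < 3 * #|D v|).
have : heavy t by rewrite /heavy tS Dt; lia.
case/(arg_minnP ht) => v /andP[vS hv] vmin.
(* The test [child c v] empties [C] at a value of [lc] or [rc] that is not a child of [v]. *)
pose C c := [set x in S | child c v && desc c x]%SET.
have Dv : #|D v| <= (#|C (lc v)| + #|C (rc v)|).+1.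
  apply: (@leq_trans #|v |: (C (lc v) :|: C (rc v))|%SET).
    apply/subset_leq_card/fintype.subsetP => x; rewrite !inE => /andP[xS dx].
    have [//|xv /=] := eqVneq x v; rewrite xS /=.
    have [c cv dc] := desc_child dx xv.
    by have [<-|<-] := child_lrc cv; rewrite cv dc ?orbT.
  by rewrite (leq_trans (leq_card_setU _ _).1)// cards1 ltnS (leq_card_setU _ _).1.
(* From [2 * #|S| + 2 <= 3 * #|D v|] and this bound, parity gives [#|S| <= 3 * #|C c|]. *)
have [c hc] : exists c, #|D v| <= (2 * #|C c|).+1.
  have [le|le] := leqP #|C (lc v)| #|C (rc v)|; [exists (rc v)|exists (lc v)]; lia.
have /card_gt0P[x] : 0 < #|C c| by lia.
rewrite inE => /and3P[xS cv dx].
have hcv := ht_child cv; have hvt := tmax vS.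
have CD : C c = D c by apply/setP => z; rewrite !inE cv.
have cS : c \in S by apply: anc_in_top xS dx _; lia.
exists c; split=> //; first by lia.
  by rewrite leqNgt; apply/negP => hD; have := vmin c; rewrite /heavy cS hD; lia.
by rewrite -CD; lia.
Qed.

End BalancedSplit.

Local Open Scope ring_scope.

Lemma frag_tree S : (1 < #|S|)%N -> connected_on tree_edge S ->
  (frag (G := tree_graph) 3^-1 S <= 1%:E)%E.
Proof.
move=> S2 /connected_top[t [tS tmax S_up]].
have [c [cS ct cle cge]] := balanced_child tS tmax S_up S2.
set A := [set x in S | desc c x]%SET in cle cge.
pose B := S :\: A.
have xA x : (x \in A) = (x \in S) && desc c x by rewrite inE.
have xB x : (x \in B) = (x \in S) && ~~ desc c x.
  by rewrite !inE; case: (x \in S); rewrite ?andbT ?andbF.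
have c_t : c != t by apply: contraTneq ct => ->; rewrite ltnn.
have /andP[cr pcS] := S_up _ cS c_t.
have cardAB : (#|A| + #|B|)%N = #|S|.
  rewrite -(cardsID A S); congr (_ + _)%N; apply: eq_card => x.
  by rewrite !inE; case: (x \in S).
have split_AB : balanced_split (G := tree_graph) 3^-1 S A B.
  apply/and5P; split.
  - apply/eqP/setP => x; rewrite finset.in_setU xA xB.
    by case: (x \in S); case: (desc c x).
  - rewrite -finset.setI_eq0; apply/eqP/setP => x.
    by rewrite finset.in_setI xA xB finset.in_set0; case: (desc c x); rewrite ?andbF.
  - apply: (top_connected (t := c)); first by rewrite xA cS desc_refl.
    move=> x; rewrite !xA => /andP[xS dx] xc; rewrite (desc_up dx xc) /=.
    rewrite desc_par ?(desc_up dx xc)// dx andbT.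
    suff /(S_up _ xS)/andP[] : x != t by [].
    by apply: contraTneq (desc_ht dx) => ->; rewrite -ltnNge.
  - apply: (top_connected (t := t)).
      by rewrite xB tS; apply/negP => /desc_ht; rewrite leqNgt ct.
    move=> x; rewrite !xB => /andP[xS dx] xt.
    have /andP[xr pS] := S_up _ xS xt; rewrite xr pS /=.
    by apply: contra dx => /(desc_par_imp xr).
  (* At alpha = 1/3, balance means [3 * #|A| <= 2 * #|S| + 1] and the same for [B], where it amounts
     to [#|S| - 1 <= 3 * #|A|]. *)
  - have cle' : 3 * #|A|%:R <= 2 * #|S|%:R + 1 :> R.
      by rewrite -!natrM natr1 ler_nat.
    have cge' : #|S|%:R <= 3 * #|A|%:R :> R by rewrite -natrM ler_nat.
    have cardAB' : #|A|%:R + #|B|%:R = #|S|%:R :> R by rewrite -natrD cardAB.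
    by rewrite ge_max; apply/andP; split; lra.
(* Only the edge from [c] to its parent joins descendants of [c] to the other vertices of [S]. *)
have cross : cross_weight (G := tree_graph) A B = 1.
  rewrite /cross_weight (bigD1 c) ?xA ?cS ?desc_refl//= [X in _ + X]big1.
    rewrite addr0 (big_pred1 (par c))// => y; rewrite xB /tree_edge /child cr /=.
    apply/andP/eqP => [[/andP[yS dy]]|->].
      case/orP => [/eqP<-//|/andP[yr /eqP yc]]; case/negP: dy.
      by apply: desc_par_imp => //; rewrite yc desc_refl.
    rewrite pcS eqxx; split=> //=; apply/negP => /desc_ht.
    by rewrite ht_par// ltnn.
  move=> x /andP[]; rewrite xA => /andP[xS dx] xc; apply: big_pred0 => y.
  apply/negP; rewrite xB => /andP[/andP[yS /negP dy]].
  case/orP => /andP[nr /eqP e]; apply: dy; last by apply: desc_par_imp; rewrite ?e.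
  by rewrite -e desc_par.
have inner : #|S|%:R - 1 <= inner_weight (G := tree_graph) S.
  (* As the edge sum of an indicator, the inner weight can be counted over lower endpoints: every
     vertex of [S] but [t] has its parent in [S]. *)
  have -> : inner_weight (G := tree_graph) S =
      edge_sum (G := tree_graph) (fun x y => ((x \in S) && (y \in S))%:R).
    rewrite /inner_weight /edge_sum; congr (_ * _); rewrite big_mkcond.
    apply: eq_bigr => x _ /=; case: (x \in S) => /=.
      rewrite big_mkcondl; apply: eq_bigr => y _.
      by case: (y \in S); rewrite /= ?mulr1 ?mulr0.
    by rewrite big1// => y _; rewrite mulr0.
  rewrite edge_sum_tree; last by move=> x y; rewrite andbC.
  rewrite (bigID (fun x => x \in S))/= ler_wpDr//.
    by apply: sumr_ge0 => x _; exact: ler0n.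
  rewrite (cardsD1 t) tS natrD addrAC subrr add0r -sum1_card natr_sum.
  rewrite [leRHS]big_mkcond [leLHS]big_mkcond; apply: ler_sum => x _.
  rewrite !inE; case xS: (x \in S); rewrite ?andbF//= andbT.
  have [_|xt] := eqVneq x t; first by case: ifP; rewrite ?ler0n.
  by have /andP[-> ->] := S_up _ xS xt.
apply: (bigmin_inf (A, B)) => //=.
rewrite lee_fin cross mulr1 ler_pdivrMr ?mul1r//.
by apply: lt_le_trans inner; rewrite subr_gt0 ltr1n.
Qed.

(** * Degrees *)

Lemma degree_tree_le x : (degree (G := tree_graph) x <= 3)%N.
Proof.
apply: (@leq_trans #|[set par x; lc x; rc x]%SET|); last first.
  by rewrite (leq_trans (leq_card_setU _ _).1)// cards1 addn1 ltnS cards2; case: eqP.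
apply/subset_leq_card/fintype.subsetP => y; rewrite !inE.
case/orP => [/andP[_ /eqP->]|/child_lrc[]->]; by rewrite eqxx ?orbT.
Qed.

Lemma max_degree_tree_le : (max_degree tree_graph <= 3)%N.
Proof. by apply/bigmax_leqP => x _; exact: degree_tree_le. Qed.

Lemma max_degree_tree x : x != r -> child (lc x) x -> child (rc x) x ->
  lc x != rc x -> max_degree tree_graph = 3%N.
Proof.
move=> xr cl cr lr; apply/eqP; rewrite eqn_leq max_degree_tree_le /=.
apply: leq_trans (leq_bigmax (x : tree_graph)).
have := ht_child cl; have := ht_child cr; have := ht_par xr => hp hr hl.
have <- : #|par x |: [set lc x; rc x]%SET|%SET = 3%N.
  rewrite cardsU1 cards2 lr !inE negb_or.
  suff [-> ->] : par x != lc x /\ par x != rc x by [].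
  by split; apply/eqP => /(congr1 ht); lia.
apply/subset_leq_card/fintype.subsetP => y; rewrite !inE /= /tree_edge.
by case/or3P => /eqP->; rewrite ?cl ?cr ?orbT// /child xr eqxx.
Qed.

(** * Perfect binary trees *)

Section PerfectBinary.
Hypothesis child_lc : forall v, (0 < ht v)%N -> child (lc v) v.
Hypothesis child_rc : forall v, (0 < ht v)%N -> child (rc v) v.
Hypothesis card_perfect : #|V| = (2 ^ (ht r).+1 - 1)%N.
Local Open Scope nat_scope.

Fixpoint hier n v : btree V :=
  if n is m.+1 then
    BNode (BNode (BLeaf v) (hier m (lc v))) (hier m (rc v))
  else BLeaf v.

Lemma size_hier n v : (size (leaves (hier n v))).+1 = 2 ^ n.+1.
Proof.
elim: n v => //= n IHn v; rewrite size_cat /= [in RHS]expnS.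
by have := IHn (lc v); have := IHn (rc v); lia.
Qed.

Lemma desc_trans_child c v x : child c v -> desc c x -> desc v x.
Proof.
move=> cv /eqP dx; have /andP[_ /eqP pc] := cv.
by rewrite /desc (ht_child cv) /= dx leqnn pc.
Qed.

Lemma mem_hier n v x : ht v = n -> (x \in leaves (hier n v)) = desc v x.
Proof.
elim: n v => [|n IHn] v hv /=.
  rewrite inE; apply/eqP/idP => [->|/desc_ht_eq]; first exact: desc_refl.
  by apply; rewrite hv.
have v0 : 0 < ht v by rewrite hv.
have := ht_child (child_lc v0); have := ht_child (child_rc v0).
rewrite hv => -[hr] [hl]; rewrite inE mem_cat !IHn//.
apply/idP/idP => [/or3P[/eqP->|dx|dx]|dx].
- exact: desc_refl.
- exact: desc_trans_child (child_lc v0) dx.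
- exact: desc_trans_child (child_rc v0) dx.
- have [//|xv /=] := eqVneq x v; have [c cv dc] := desc_child dx xv.
  by have [<-|<-] := child_lrc cv; rewrite dc ?orbT.
Qed.

(** Every vertex occurs among the leaves and the list has length [#|V|], so nothing is repeated;
    disjointness of the subtrees follows from the count. *)
Lemma hier_hierarchy : hierarchy (hier (ht r) r).
Proof.
have mem x : x \in leaves (hier (ht r) r) by rewrite mem_hier// /desc anc_root.
apply: uniq_perm; rewrite ?enum_uniq//; last by move=> x; rewrite mem mem_enum.
apply: (leq_size_uniq (enum_uniq V)) => //.
by rewrite -cardE card_perfect -ltnS size_hier subn1 prednK ?expn_gt0.
Qed.

(** Distances grow linearly with the height, clusters exponentially. At height [n + 1], the inner
    node separates [v] from a vertex within distance [n + 1] in a cluster of size [2 ^ (n + 1)]; the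
    outer node separates vertices within distance [2 * (n + 1)] in one of size [2 ^ (n + 2) - 1]. *)
Lemma gdist_le_lca_hier n v x y : ht v = n -> desc v x -> desc v y -> x != y ->
  gdist (G := tree_graph) x y <= (size (leaves (lca (hier n v) x y))).-1.
Proof.
elim: n v => [|n IHn] v hv dx dy xy.
  move: xy; rewrite (desc_ht_eq dx) ?hv// (desc_ht_eq dy) ?hv//.
  by rewrite eqxx.
have v0 : 0 < ht v by rewrite hv.
have := ht_child (child_lc v0); have := ht_child (child_rc v0).
rewrite hv => -[hr] [hl].
have hn : n.+1 <= ht r by rewrite -hv ht_le_root.
have expn_n : n.+1 < 2 ^ n.+1 by exact: ltn_expl.
have ancx : anc n.+1 x = v by apply/eqP; rewrite -hv.
have ancy : anc n.+1 y = v by apply/eqP; rewrite -hv.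
rewrite [lca _ _ _]/=; case: ifP => [/andP[]|_].
  case: ifP => [/andP[]|_ xl yl].
    by rewrite !inE => /eqP ex /eqP ey; rewrite ex ey eqxx in xy.
  case: ifP => [/andP[]|nl]; first by rewrite !mem_hier// => d1 d2; exact: IHn.
  apply: (@leq_trans n.+1); last by have := size_hier n (lc v); rewrite /=; lia.
  move: xl yl nl; rewrite !inE.
  have [xv _|_ /= -> /=] := eqVneq x v; last first.
    case: eqP => [yv _ _|_ /= ->//].
    by rewrite (leq_trans (gdist_common_anc (m := n.+1) (n := 0) hn _ _)) ?addn0// ancx yv.
  move=> _ _.
  by rewrite (leq_trans (gdist_common_anc (m := 0) (n := n.+1) _ hn _))// ancy.
case: ifP => [/andP[]|_]; first by rewrite !mem_hier// => d1 d2; exact: IHn.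
apply: (leq_trans (gdist_common_anc hn hn _)); first by rewrite ancx.
by have := size_hier n.+1 v; rewrite [hier _ _]/= [2 ^ n.+2]expnS; lia.
Qed.

(** Descend from [v] to [par x], whose subtree has [2 ^ (ht x + 2) - 1] vertices and contains both
    ends of the edge. *)
Lemma size_lca_hier_par n v x : ht v = n -> x != r -> desc v (par x) ->
  size (leaves (lca (hier n v) x (par x))) <= 2 ^ (ht x).+2.
Proof.
elim: n v => [|n IHn] v hv xr dp.
  by have := desc_ht dp; rewrite hv ht_par.
have [pv|pv] := eqVneq (par x) v.
  have <- : n.+1 = (ht x).+1 by rewrite -ht_par// pv.
  rewrite (leq_trans (size_lca _ _ _))//.
  by have := size_hier n.+1 v; lia.
have v0 : 0 < ht v by rewrite hv.
have := ht_child (child_lc v0); have := ht_child (child_rc v0).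
rewrite hv => -[hr] [hl].
have /negPf xv : x != v.
  by apply: contraTneq (desc_ht dp) => <-; rewrite ht_par ?ltnn.
rewrite [lca _ _ _]/= !inE !mem_hier// xv (negPf pv) /=.
have [c cv dc] := desc_child dp pv.
have dx := desc_par_imp xr dc.
have dpl : desc (lc v) (par x) -> desc (lc v) x by exact: desc_par_imp.
have [pl|npl] := boolP (desc (lc v) (par x)).
  by rewrite dpl//=; exact: IHn.
rewrite andbF; have [ec|ec] := child_lrc cv; first by rewrite -ec dc in npl.
by rewrite -ec dx dc /= ec; apply: IHn => //; rewrite -ec.
Qed.

(** * Height sums and the two optima *)

Lemma sum_hier (F : nat -> nat) n v : ht v = n ->
  \sum_(x <- leaves (hier n v)) F (ht x) =
  if n is m.+1 then
    F n + \sum_(x <- leaves (hier m (lc v))) F (ht x)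
        + \sum_(x <- leaves (hier m (rc v))) F (ht x)
  else F 0.
Proof.
by case: n => [|n] hv /=; rewrite big_cons hv ?big_nil ?addn0 ?big_cat /= ?addnA.
Qed.

(** The sum obeys s(n+1) = 2 s(n) + 2 (n+2); the correction [2 * n + 6] makes the induction
    exact. *)
Lemma sum_hier_linear n v : ht v = n ->
  \sum_(x <- leaves (hier n v)) 2 * (ht x).+1 + (2 * n + 6) = 2 ^ n.+3.
Proof.
elim: n v => [|n IHn] v hv; rewrite (sum_hier (fun k => 2 * k.+1) hv)//.
have v0 : 0 < ht v by rewrite hv.
have := ht_child (child_lc v0); have := ht_child (child_rc v0).
rewrite hv => -[hr] [hl]; have := IHn (lc v) (esym hl).
by have := IHn (rc v) (esym hr); rewrite [2 ^ n.+4]expnS; lia.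
Qed.

(** Height k occurs 2^(n-k) times, so each of the n+1 heights contributes 2^(n+2). *)
Lemma sum_hier_exp n v : ht v = n ->
  \sum_(x <- leaves (hier n v)) 2 ^ (ht x).+2 = n.+1 * 2 ^ n.+2.
Proof.
elim: n v => [|n IHn] v hv; rewrite (sum_hier (fun k => 2 ^ k.+2) hv)//.
have v0 : 0 < ht v by rewrite hv.
have := ht_child (child_lc v0); have := ht_child (child_rc v0).
rewrite hv => -[hr] [hl]; rewrite !IHn//.
by rewrite [2 ^ n.+3]expnS; lia.
Qed.

Lemma sum_vertices (F : V -> nat) :
  \sum_x F x = \sum_(x <- leaves (hier (ht r) r)) F x.
Proof. by rewrite (perm_big _ hier_hierarchy) big_enum. Qed.

Local Open Scope ring_scope.

Lemma hier_dominates :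
  dominates (G := tree_graph) (hcost (G := tree_graph) (hier (ht r) r)).
Proof.
move=> x y; rewrite /hcost ler_nat.
have [->|xy] := eqVneq x y; first by rewrite gdistxx.
rewrite hcard_size ?hierarchy_uniq//; last exact: hier_hierarchy.
by apply: gdist_le_lca_hier; rewrite // /desc anc_root.
Qed.

Lemma OPT_card_perfect_ge : #|V|%:R * ln #|V|%:R / 2 <= OPT_card tree_graph.
Proof. exact: OPT_card_tree_ge hier_hierarchy hier_dominates. Qed.

Lemma OPT_card_perfect_le :
  OPT_card tree_graph <= ((ht r).+1 * 2 ^ (ht r).+2)%:R.
Proof.
rewrite -(sum_hier_exp (erefl (ht r))) -sum_vertices.
apply: (@le_trans _ _ (edge_sum (G := tree_graph)
                         (hcost (G := tree_graph) (hier (ht r) r)))).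
  apply: ge_inf; last first.
    by exists (hier (ht r) r) => //; split; [exact: hier_hierarchy | exact: hier_dominates].
  exists (#|V|%:R - 1) => _ [H [Hh Hd] <-]; apply: edge_sum_dominating_ge => //.
  by move=> x y; rewrite /hcost hcard_sym.
rewrite -tree_cost_hierarchy; last exact: hier_hierarchy.
rewrite ler_nat /tree_cost (perm_big _ hier_hierarchy) big_enum_cond /=.
rewrite [leqRHS](bigID (fun x => (x != r) && (par x \in leaves (hier (ht r) r))))/=.
apply: leq_trans (leq_addr _ _); apply: leq_sum => x /andP[xr _].
rewrite (leq_trans (leq_pred _))//; apply: size_lca_hier_par => //.
by rewrite /desc anc_root.
Qed.

Lemma OPT_free_perfect_le : OPT_free tree_graph <= (2 ^ (ht r).+3)%:R.
Proof.
apply: le_trans OPT_free_tree_le _.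
by rewrite ler_nat sum_vertices -(sum_hier_linear (erefl (ht r))) leq_addr.
Qed.

Lemma OPT_ratio_perfect : (0 < ht r)%N ->
  16^-1 * ln #|V|%:R <= OPT_card tree_graph / OPT_free tree_graph
                     <= 16 * ln (#|V|%:R : R).
Proof.
move=> h0; have := OPT_card_perfect_ge; have := OPT_card_perfect_le.
have := OPT_free_perfect_le; have := OPT_free_tree_ge.
move: (OPT_card _) (OPT_free _) => oc fr.
set n : R := #|V|%:R; set h : R := (ht r)%:R; set p : R := (2 ^ ht r)%:R.
have nE : n = 2 * p - 1.
  rewrite /n card_perfect natrB ?expn_gt0// expnS natrM.
  by [].
have p2 : 2 <= p by rewrite /p ler_nat -(prednK h0) expnS leq_pmulr ?expn_gt0.
have h1 : 1 <= h by rewrite ler1n.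
(* Apply ln(1 + t) <= t at t = -1/2. *)
have ln_half : 2^-1 <= ln 2 :> R.
  have := @le_ln1Dx R (- 2^-1); rewrite (_ : 1 - 2^-1 = 2^-1 :> R); last by lra.
  by rewrite lnV ?posrE//; lra.
have lnn : h / 2 <= ln n.
  apply: (@le_trans _ _ (ln p)); last by rewrite ler_ln ?posrE; lra.
  rewrite /p natrX lnXn// -[ln 2 *+ _]mulr_natl -/h.
  by apply: ler_wpM2l; lra.
rewrite !expnS !natrM -/p -[(ht r).+1%:R]natr1 -/h => fge fle cle cge.
have fr0 : 0 < fr by lra.
rewrite ler_pdivlMr// ler_pdivrMr//; apply/andP; split.
  (* [fr <= 8 * p] and [p <= n] give [ln n * fr / 16 <= n * ln n / 2]. *)
  apply: le_trans cge.
  have : ln n * fr <= ln n * (16 * p / 2) by apply: ler_wpM2l; lra.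
  have : ln n * p <= ln n * n by apply: ler_wpM2l; lra.
  lra.
(* The left side is [4 * (h + 1) * p <= 8 * h * p]; then [p <= fr] and [h <= 2 * ln n] give the
   constant 16. *)
apply: le_trans cle _.
have a : h * p <= h * fr by apply: ler_wpM2l; lra.
have b : h / 2 * fr <= ln n * fr by apply: ler_wpM2r; lra.
have c : p <= h * p by rewrite ler_peMl//; lra.
lra.
Qed.

End PerfectBinary.

End RootedTree.

(** * Binary heaps *)

Section Heap.
Local Open Scope nat_scope.
Variable h : nat.

Lemma heap_gt0 : 0 < 2 ^ h.+1 - 1.
Proof. by rewrite subn_gt0 -[X in X < _](expn0 2) ltn_exp2l. Qed.

(* Binary heap order: the vertices [2i+1] and [2i+2] are the children of [i],
   so that [i] lies at depth [log_2 (i+1)]. *)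
Definition heap := 'I_(2 ^ h.+1 - 1).
Definition heap_root : heap := Ordinal heap_gt0.
Definition heap_par (i : heap) : heap := insubd heap_root i.-1./2.
Definition heap_ht (i : heap) : nat := h - trunc_log 2 i.+1.
(** At a leaf the index is out of range and [insubd] falls back to the root, which [child] never
    accepts as a child. *)
Definition heap_lc (i : heap) : heap := insubd heap_root i.*2.+1.
Definition heap_rc (i : heap) : heap := insubd heap_root i.*2.+2.

Lemma val_heap_par (i : heap) : heap_par i = i.-1./2 :> nat.
Proof. by rewrite val_insubd; case: ifP => // /negP[]; have := ltn_ord i; lia. Qed.

Lemma heap_depth_le (i : heap) : trunc_log 2 i.+1 <= h.
Proof.
rewrite -ltnS -(@ltn_exp2l 2)// (leq_ltn_trans (trunc_logP _ _))//.
by have := ltn_ord i; lia.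
Qed.

Lemma heap_root_neq (i : heap) : (i != heap_root) = (0 < i).
Proof. by rewrite lt0n. Qed.

Lemma heap_ht_root : heap_ht heap_root = h.
Proof. by rewrite /heap_ht trunc_log1 subn0. Qed.

Lemma heap_ht_par (i : heap) : i != heap_root -> heap_ht (heap_par i) = (heap_ht i).+1.
Proof.
rewrite heap_root_neq /heap_ht val_heap_par => i0; have := heap_depth_le i.
(* Halving the shifted index [i + 1] gives that of the parent and lowers the binary logarithm by
   one. *)
rewrite trunc_log2S// (_ : i.+1./2 = (i.-1./2).+1); lia.
Qed.

Lemma heap_ht_lt_root (i : heap) : i != heap_root -> heap_ht i < heap_ht heap_root.
Proof.
rewrite heap_root_neq heap_ht_root /heap_ht => i0; have := heap_depth_le i.
by have := trunc_log_gt0 2 i.+1; lia.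
Qed.

Lemma heap_child_lrc (c v : heap) : child heap_root heap_par c v ->
  c = heap_lc v \/ c = heap_rc v.
Proof.
case/andP; rewrite heap_root_neq => c0 /eqP <-.
have := ltn_ord c; have := odd_double_half c.-1; case: (odd c.-1) => e lt.
  right; apply: val_inj; rewrite val_insubd val_heap_par ifT //=; lia.
left; apply: val_inj; rewrite val_insubd val_heap_par ifT //=; lia.
Qed.

(** Positive height means depth below [h], so [v + 1 < 2 ^ h], and doubling stays in range. *)
Lemma heap_children_lt (v : heap) : 0 < heap_ht v -> v.*2.+2 < 2 ^ h.+1 - 1.
Proof.
rewrite subn_gt0 => lt.
have : v.+1 < 2 ^ h.
  by rewrite (leq_trans (trunc_log_ltn v.+1 (isT : 1 < 2)))// leq_exp2l.
by have := expnS 2 h; lia.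
Qed.

Lemma heap_child_lc (v : heap) : 0 < heap_ht v ->
  child heap_root heap_par (heap_lc v) v.
Proof.
move=> /heap_children_lt lt.
have e : heap_lc v = v.*2.+1 :> nat by rewrite val_insubd ifT//=; lia.
rewrite /child heap_root_neq e /=; apply/eqP/val_inj.
by rewrite /= val_heap_par e /=; lia.
Qed.

Lemma heap_child_rc (v : heap) : 0 < heap_ht v ->
  child heap_root heap_par (heap_rc v) v.
Proof.
move=> /heap_children_lt lt.
have e : heap_rc v = v.*2.+2 :> nat by rewrite val_insubd ifT.
rewrite /child heap_root_neq e /=; apply/eqP/val_inj.
by rewrite /= val_heap_par e /=; lia.
Qed.

Lemma heap_lc_neq_rc (v : heap) : 0 < heap_ht v -> heap_lc v != heap_rc v.
Proof.
move=> /heap_children_lt lt; apply/eqP => /(congr1 val).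
by rewrite /= !val_insubd !ifT//=; lia.
Qed.

Lemma card_heap : #|{: heap}| = 2 ^ (heap_ht heap_root).+1 - 1.
Proof. by rewrite heap_ht_root card_ord. Qed.

End Heap.

Theorem theorem14 (R : realType) :
  exists B : nat -> wgraph R,
    [/\ forall h : nat, (1 <= h)%N ->
          [/\ unweighted (B h), is_tree (B h),
              (max_degree (B h) <= 3)%N,
              (2 <= h)%N -> max_degree (B h) = 3%N &
              #|B h| = (2 ^ h.+1 - 1)%N],
        exists c C : R,
          [/\ 0 < c, c <= C &
              forall h : nat, (1 <= h)%N ->
                c * ln (#|B h|%:R) <= OPT_card (B h) / OPT_free (B h)
                                   <= C * ln (#|B h|%:R)] &
        forall (h : nat) (S : {set B h}), (1 <= h)%N -> (2 <= #|S|)%N ->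
          connected_on (@edge R (B h)) S -> (frag (3^-1) S <= 1%:E)%E].
Proof.
exists (fun h => tree_graph (@heap_ht_par h) (@heap_ht_lt_root h) R); split.
- move=> h h1; split.
  + by [].
  + exact: tree_acyclic (@heap_ht_par h).
  + exact: max_degree_tree_le (@heap_child_lrc h).
  (* The left child of the root has a parent and, since [h >= 2], two children. *)
  + move=> h2; pose x := heap_lc (heap_root h).
    have r0 : (0 < heap_ht (heap_root h))%N by rewrite heap_ht_root.
    have cx := heap_child_lc r0; have /andP[xr _] := cx.
    have x0 : (0 < heap_ht x)%N.
      have := ht_child (@heap_ht_par h) cx; rewrite heap_ht_root => e.
      by rewrite -ltnS -e.
    apply: (max_degree_tree _ _ _ (@heap_child_lrc h) (x := x)) => //.
    * exact: heap_child_lc.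
    * exact: heap_child_rc.
    * exact: heap_lc_neq_rc.
  + exact: card_ord.
- exists 16^-1, 16; split; [lra | lra |] => h h1.
  have h0 : (0 < heap_ht (heap_root h))%N by rewrite heap_ht_root.
  exact (OPT_ratio_perfect (@heap_ht_par h) (@heap_ht_lt_root h) R
    (@heap_child_lrc h) (@heap_child_lc h) (@heap_child_rc h) (card_heap h) h0).
- move=> h S _.
  exact (@frag_tree _ _ _ _ (@heap_ht_par h) (@heap_ht_lt_root h) R
    _ _ (@heap_child_lrc h) S).
Qed.
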